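(* Let $\lambda\in(0,1]$ and let $\nu_\lambda$ be the probability measure on $\mathbb{R}$ given by $$\nu_\lambda(dx)=\frac{2-\lambda}{\pi}\,\frac{\sqrt{1-x^2}}{1-\lambda(2-\lambda)x^2}\,\mathbf{1}_{[-1,1]}(x)\,dx .$$ Then $$\psi_\lambda(u,x)=\frac{1-\frac{\lambda}{2-\lambda}u^2}{1-2ux+u^2}$$ is a generating function for $\nu_\lambda$, corresponding to the polynomials $$Q_n^\lambda(x)=U_n(x)-\frac{\lambda}{2-\lambda}U_{n-2}(x),\qquad n\ge0;$$ that is, $\psi_\lambda(u,x)=\sum_{n\ge0}Q_n^\lambda(x)u^n$ and the polynomials $(Q_n^\lambda)_{n\ge0}$ are orthogonal with respect to $\nu_\lambda$. Moreover, the Jacobi-Szegö parameters of $\nu_\lambda$ are $\alpha_n=0$ for $n\ge0$, $\omega_1=\frac{1}{2(2-\lambda)}$, and $\omega_n=\frac14$ for $n\ge2$.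
   Context: $U_n$ denotes the $n$-th Tchebycheff polynomial of the second kind, $U_n(\cos\alpha)=\sin((n+1)\alpha)/\sin\alpha$ for $n\ge0$, with the convention $U_{-1}=U_{-2}:=0$. The expansion of $\psi_\lambda$ is for $|x|\le1$ and $|u|<1$. For a measure $\mu$ on $\mathbb{R}$ with finite moments of all orders and not supported by a finite set, with monic orthogonal polynomials $(P_n)_{n\ge0}$, the Jacobi-Szegö parameters $(\alpha_n,\omega_n)$ are defined by the recurrence $(x-\alpha_n)P_n(x)=P_{n+1}(x)+\omega_nP_{n-1}(x)$, $n\ge0$, $P_{-1}:=0$, with $\alpha_n\in\mathbb{R}$, $\omega_n>0$ (the value $\omega_0$ is irrelevant). The measure $\nu_\lambda$ is the image of the spectral measure $\mu_{\lambda,1/2}(dx)=\frac{1}{\pi\lambda}\frac{\sqrt{(x_+-x)(x-x_-)}}{x(1-x)}\mathbf{1}_{[x_-,x_+]}(x)dx$, $x_\pm=\frac{(\sqrt\lambda\pm\sqrt{2-\lambda})^2}{4}$, of the stationary free Jacobi process with parameters $(\lambda,1/2)$ under the map $x\mapsto\frac{2x-1}{\sqrt{\lambda(2-\lambda)}}$. *)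

(* Defs.v *)
From HB Require Import structures.
From mathcomp Require Import all_boot all_order all_algebra.
From mathcomp Require Import all_classical all_reals all_analysis.
From mathcomp Require Import measurable_realfun ring.

Set Implicit Arguments.
Unset Strict Implicit.
Unset Printing Implicit Defensive.

Import Order.TTheory GRing.Theory Num.Theory.
Import numFieldNormedType.Exports.

Local Open Scope classical_set_scope.
Local Open Scope ring_scope.

Section Tchebycheff.
Variable R : realType.
Implicit Types (n : nat) (a : R).

Fixpoint chebyU n : {poly R} :=
  match n with
  | 0 => 1
  | n'.+1 => match n' with
             | 0 => 2%:P * 'X
             | n''.+1 => 2%:P * 'X * chebyU n' - chebyU n''
             end
  end.

Lemma chebyUSS n : chebyU n.+2 = 2%:P * 'X * chebyU n.+1 - chebyU n.
Proof. by []. Qed.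

(* The trigonometric characterization of the second-kind polynomials. *)
Lemma chebyU_cos n a :
  sin a != 0 -> (chebyU n).[cos a] = sin (n.+1%:R * a) / sin a.
Proof.
move=> sa0; apply: (mulIf sa0); rewrite divfK//.
suff [] : (chebyU n).[cos a] * sin a = sin (n.+1%:R * a) /\
          (chebyU n.+1).[cos a] * sin a = sin (n.+2%:R * a) by [].
elim: n => [|n [IH0 IH1]]; split.
- by rewrite /= hornerE !mul1r.
- have -> : 2%:R * a = a + a by ring.
  by rewrite /= !hornerE sinD; ring.
- exact: IH1.
- have -> : n.+3%:R * a = n.+2%:R * a + a by rewrite -natr1; ring.
  have sE : sin (n.+1%:R * a) = sin (n.+2%:R * a - a).
    by congr sin; rewrite -[n.+2%:R]natr1; ring.
  rewrite chebyUSS hornerD hornerN !hornerM hornerC hornerX mulrBl IH0 sE.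
  by rewrite -[_ * _ * sin a]mulrA IH1 sinB sinD; ring.
Qed.

End Tchebycheff.

(* The second argument of the subtraction is U_{n-2}, with
   U_{-1} = U_{-2} = 0. *)
Definition Qpoly (R : realType) (lam : R) (n : nat) : {poly R} :=
  chebyU R n
  - (lam / (2 - lam)) *: (if n is n'.+2 then chebyU R n' else 0).

Definition psi (R : realType) (lam u x : R) : R :=
  (1 - lam / (2 - lam) * u ^+ 2) / (1 - 2 * u * x + u ^+ 2).

Lemma measurable_invr (R : realType) :
  measurable_fun setT (@GRing.inv R : R -> R).
Proof.
rewrite -(setvU [set (0 : R)]); apply/measurable_funU => //.
  exact: measurableC.
split; last exact: measurable_fun_set1.
apply: open_continuous_measurable_fun.
  by apply: closed_openC; exact: closed_eq.
by move=> x; rewrite inE/= => /eqP x0; exact: inv_continuous.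
Qed.

Section nu.
Variables (R : realType) (lam : R).

(* For lam = 1 the denominator vanishes at x = -1 and x = 1, where the
   density then takes the value 0. *)
Definition nu_pdf (x : R) : R :=
  (2 - lam) / pi * (Num.sqrt (1 - x ^+ 2) / (1 - lam * (2 - lam) * x ^+ 2))
  * \1_`[-1, 1] x.

Definition nu (hlam : 0 < lam <= 1) : set (measurableTypeR R) -> \bar R :=
  fun A => (\int[lebesgue_measure]_(x in A) (nu_pdf x)%:E)%E.

Hypothesis hlam : 0 < lam <= 1.

Lemma nu_pdf_ge0 x : 0 <= nu_pdf x.
Proof.
have /andP[lam0 lam1] := hlam.
rewrite /nu_pdf indicE; case: (boolP (x \in _)) => [|_]; last by rewrite mulr0.
rewrite inE/= in_itv/= => /andP[x1 x2]; rewrite mulr1 mulr_ge0//.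
  by rewrite divr_ge0 ?pi_ge0// subr_ge0 (le_trans lam1)// ler1n.
rewrite divr_ge0 ?sqrtr_ge0// subr_ge0.
have xx1 : x ^+ 2 <= 1.
  by rewrite -[leLHS]real_normK ?num_real// expr_le1// ler_norml x1.
apply: (le_trans _ xx1); rewrite ler_piMl ?sqr_ge0//.
by rewrite -subr_ge0 (_ : _ - _ = (1 - lam) ^+ 2) ?sqr_ge0//; ring.
Qed.

Lemma measurable_nu_pdf : measurable_fun setT nu_pdf.
Proof.
apply: measurable_funM; last exact: measurable_indic.
apply: measurable_funM => //; apply: measurable_funM.
  apply: (measurableT_comp
    (continuous_measurable_fun (@sqrt_continuous R))).
  by apply: measurable_funB => //; exact: exprn_measurable.
apply: (measurableT_comp (@measurable_invr R)).
apply: measurable_funB => //; apply: measurable_funM => //.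
Qed.

Let nu0 : nu hlam set0 = 0%E.
Proof. by rewrite /nu integral_set0. Qed.

Let nu_ge0 A : (0 <= nu hlam A)%E.
Proof. by apply: integral_ge0 => x _; rewrite lee_fin nu_pdf_ge0. Qed.

Let nu_sigma_additive : semi_sigma_additive (nu hlam).
Proof.
move=> /= F mF tF mUF; rewrite /nu; apply: cvg_toP.
  apply: ereal_nondecreasing_is_cvgn => m n mn.
  apply: lee_sum_nneg_natr => // k _ _.
  by apply: integral_ge0 => x _; rewrite lee_fin nu_pdf_ge0.
rewrite ge0_integral_bigcup//=.
- by apply: measurable_funTS; apply/measurable_EFinP; exact: measurable_nu_pdf.
- by move=> x _; rewrite lee_fin nu_pdf_ge0.
Qed.

HB.instance Definition _ :=
  isMeasure.Build _ _ _ (nu hlam) nu0 nu_ge0 nu_sigma_additive.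

End nu.

Section orthogonal_polynomials.
Variables (R : realType).
Variable mu : {measure set (measurableTypeR R) -> \bar R}.

Definition finite_moments : Prop :=
  forall n : nat, mu.-integrable setT (fun x => (x ^+ n)%:E).

Definition not_finitely_supported : Prop :=
  forall F : set (measurableTypeR R), finite_set F -> mu (~` F) <> 0%E.

(* The integrability clause is needed because the library's integral is total:
   it has a value also for functions that are not integrable. *)
Definition orthogonal_polynomials (P : nat -> {poly R}) : Prop :=
  (forall n, size (P n) = n.+1) /\
  (forall m n, m <> n ->
     mu.-integrable setT (fun x => ((P m).[x] * (P n).[x])%:E) /\
     (\int[mu]_x ((P m).[x] * (P n).[x])%:E = 0)%E).

(* omega 0 multiplies P_{-1} = 0 and is left unconstrained. *)
Definition Jacobi_Szego_parameters (alpha omega : nat -> R) : Prop :=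
  [/\ finite_moments,
      not_finitely_supported,
      forall n, (0 < n)%N -> 0 < omega n &
      exists P : nat -> {poly R},
        [/\ orthogonal_polynomials P,
            forall n, P n \is monic &
            forall n, ('X - (alpha n)%:P) * P n =
              P n.+1 + omega n *: (if n is n'.+1 then P n' else 0)]].

End orthogonal_polynomials.

(* Main.v *)
(** Write L p for the integral of p against nu_lam, r = lam / (2 - lam) and
    w x = sqrt (1 - x^2).  Up to a constant, 1 - lam (2 - lam) x^2 cancels the
    denominator of the density, and
      Q_n - r Q_{n+2} = 4 / (2 - lam)^2 (1 - lam (2 - lam) X^2) U_n   (n >= 1),
    so L Q_n = r L Q_{n+2} because U_n is orthogonal to 1 for the semicircle
    weight w.  Since r <> 0, the two values L Q_1 = 0 (symmetry) and L Q_2 = 0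
    (the identity for n = 0, where 1 + r replaces Q_0, and L 1 = 1) give
    L Q_n = 0 for all n >= 1.  With the three-term recurrence this forces
    orthogonality, and an induction along the recurrence shows that its
    coefficients are determined by L.  The generating function follows from a
    closed form for its partial sums and the bound |U_n| <= n + 1 on [-1, 1]. *)
From HB Require Import structures.
Require Import Defs.
From mathcomp Require Import all_boot all_order all_algebra.
From mathcomp Require Import all_classical all_reals all_analysis.
From mathcomp Require Import measurable_realfun ring lra zify.

Import Order.TTheory GRing.Theory Num.Theory.
Import numFieldNormedType.Exports.

Local Open Scope classical_set_scope.
Local Open Scope ring_scope.

Set Implicit Arguments.
Unset Strict Implicit.
Unset Printing Implicit Defensive.

(** * Three-term recurrences and orthogonality for a linear form on polynomials *)

Section three_term_recurrence.
Variables (K : fieldType) (L : {scalar {poly K}}).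
Implicit Types (alpha omega : nat -> K) (p : {poly K}) (q P : nat -> {poly K}).

Definition three_term alpha omega q := forall n,
  ('X - (alpha n)%:P) * q n =
  q n.+1 + omega n *: (if n is n'.+1 then q n' else 0).

Definition orthogonal_for q := forall m n, m <> n -> L (q m * q n) = 0.

(** Trading one factor ['X] for neighbouring indices lowers the exponent by one and the index by at
    most one, so the exponent stays below the index until it is 0, where [L (q n.+1) = 0]
    applies. *)
Lemma three_term_orthogonal_lt alpha omega q n p : three_term alpha omega q ->
  (forall n, L (q n.+1) = 0) -> (size p <= n)%N -> L (p * q n) = 0.
Proof.
move=> qE L0; have LXn k : forall n, (k < n)%N -> L ('X^k * q n) = 0.
  elim: k => [|k IH] [//|m]; first by rewrite expr0 mul1r.
  rewrite ltnS => km; have := qE m.+1.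
  move=> /(congr1 (fun s => 'X^k * s)) /eqP.
  rewrite mulrBl mulrBr mulrDr subr_eq mulrA -exprSr => /eqP ->.
  rewrite -mul_polyC !(mulrCA 'X^k) !mul_polyC !linearD !linearZ/=.
  by rewrite !IH ?scaler0 ?mulr0 ?addr0// ltnW// ltnW.
move=> pn; rewrite -[p]coefK poly_def mulr_suml linear_sum big1// => i _.
by rewrite -scalerAl linearZ/= LXn ?mulr0//; exact: leq_trans (ltn_ord i) pn.
Qed.

Lemma three_term_orthogonal alpha omega q : three_term alpha omega q ->
  (forall n, size (q n) = n.+1) -> (forall n, L (q n.+1) = 0) ->
  orthogonal_for q.
Proof.
move=> qE sq L0 m n /eqP; rewrite neq_ltn => /orP[mn|nm].
  by rewrite (three_term_orthogonal_lt qE L0)// sq.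
by rewrite mulrC (three_term_orthogonal_lt qE L0)// sq.
Qed.

(** Both sides equal [L ('X * q n * q n.+1)]: expand ['X * q n] for the left one and ['X * q n.+1]
    for the right one. Positive [omega] thus propagates positivity of the squared norms. *)
Lemma three_term_norm alpha omega q n : three_term alpha omega q ->
  orthogonal_for q ->
  L (q n.+1 * q n.+1) = omega n.+1 * L (q n * q n).
Proof.
move=> qE oq; have XE m : 'X * q m =
    q m.+1 + omega m *: (if m is m'.+1 then q m' else 0) + alpha m *: q m.
  by rewrite -qE mulrBl mul_polyC subrK.
have -> : L (q n.+1 * q n.+1) = L (('X * q n) * q n.+1).
  rewrite XE !mulrDl -!scalerAl !linearD !linearZ/= [L (q n * _)]oq; last first.
    by apply/eqP; rewrite neq_ltn leqnn.
  rewrite mulr0 addr0; case: n => [|n].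
    by rewrite mul0r linear0 mulr0 addr0.
  by rewrite [L (q n * _)]oq ?mulr0 ?addr0//; apply/eqP; rewrite neq_ltn leqnSn.
have -> : 'X * q n * q n.+1 = q n * ('X * q n.+1) by rewrite mulrCA mulrA.
rewrite XE !mulrDr -!scalerAr !linearD !linearZ/=.
rewrite [L (q n * q n.+2)]oq; last first.
  by apply/eqP; rewrite neq_ltn leqnSn.
rewrite [L (q n * q n.+1)]oq; last by apply/eqP; rewrite neq_ltn leqnn.
by rewrite mulr0 addr0 add0r.
Qed.

(** While two consecutive members agree, the next ones differ by a combination of [q n] and
    [q n.-1]. Pairing with each of these isolates one coefficient times a nonzero squared norm, and
    orthogonality of both families makes it vanish. *)
Lemma three_term_unique alpha omega alpha' omega' q P :
  three_term alpha omega q -> three_term alpha' omega' P ->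
  q 0%N = P 0%N -> orthogonal_for q -> orthogonal_for P ->
  (forall n, L (q n * q n) != 0) ->
  forall n, alpha' n = alpha n /\ omega' n.+1 = omega n.+1.
Proof.
move=> qE PE qP0 oq oP Lq.
(* At index 0 the [omega] term is scaled from 0, so nothing can be said about [omega' 0]; hence the
   guard [0 < n]. *)
have step n : P n = q n ->
    (if n is n'.+1 then P n' else 0) = (if n is n'.+1 then q n' else 0) ->
    [/\ alpha' n = alpha n,
      (0 < n)%N -> omega' n = omega n & P n.+1 = q n.+1].
  move=> En Em.
  have PnE : P n.+1 = q n.+1 + (alpha n - alpha' n) *: q n +
      (omega n - omega' n) *: (if n is n'.+1 then q n' else 0).
    have := PE n; rewrite Em En => /eqP; rewrite -subr_eq => /eqP <-.
    rewrite [(omega n - _) *: _]scalerBl [(alpha n - _) *: _]scalerBl.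
    have := qE n; rewrite !mulrBl !mul_polyC => /eqP.
    by rewrite subr_eq => /eqP ->; ring.
  have an : alpha' n = alpha n.
    have : L (P n.+1 * P n) = 0.
      by apply: oP; apply/eqP; rewrite neq_ltn leqnn orbT.
    rewrite En PnE !mulrDl -!scalerAl !linearD !linearZ/=.
    rewrite [L (q n.+1 * _)]oq; last first.
      by apply/eqP; rewrite neq_ltn leqnn orbT.
    have -> : L ((if n is n'.+1 then q n' else 0) * q n) = 0.
      case: n {En Em PnE} => [|n]; first by rewrite mul0r linear0.
      by apply: oq; apply/eqP; rewrite neq_ltn leqnn.
    rewrite mulr0 addr0 add0r => /eqP; rewrite mulf_eq0 (negbTE (Lq n)) orbF.
    by rewrite subr_eq0 => /eqP.
  have on : (0 < n)%N -> omega' n = omega n.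
    case: n En Em PnE an => [//|n] En Em PnE an _.
    have : L (P n.+2 * P n) = 0.
      by apply: oP; apply/eqP; rewrite neq_ltn leqnSn orbT.
    rewrite Em PnE an subrr scale0r addr0 mulrDl -scalerAl linearD linearZ/=.
    rewrite oq; last by apply/eqP; rewrite neq_ltn leqnSn orbT.
    rewrite add0r => /eqP; rewrite mulf_eq0 (negbTE (Lq n)) orbF.
    by rewrite subr_eq0 => /eqP.
  split => //; rewrite PnE an subrr scale0r addr0.
  case: n {En Em PnE an} on => [|n] on; first by rewrite scaler0 addr0.
  by rewrite on// subrr scale0r addr0.
have PqE n : P n = q n /\ P n.+1 = q n.+1.
  elim: n => [|n [En En1]]; first by have [] := step 0%N (esym qP0) erefl.
  by split=> //; have [] := step n.+1 En1 En.
move=> n; split.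
  by case: n => [|n]; [have [] := step 0%N (esym qP0) erefl |
    have [En En1] := PqE n; have [] := step n.+1 En1 En].
by have [En En1] := PqE n; have [_ ->] := step n.+1 En1 En.
Qed.

End three_term_recurrence.

(** * Chebyshev polynomials, the family [Qpoly] and its generating function *)

Section chebyshev.
Variable R : realType.
Implicit Types (lam x u : R) (n : nat).

Lemma size_lead_chebyU n :
  size (chebyU R n) = n.+1 /\ lead_coef (chebyU R n) = 2 ^+ n.
Proof.
suff [] : (size (chebyU R n) = n.+1 /\ lead_coef (chebyU R n) = 2 ^+ n) /\
  (size (chebyU R n.+1) = n.+2 /\ lead_coef (chebyU R n.+1) = 2 ^+ n.+1) by [].
have two0 : (2 : R) != 0 by rewrite pnatr_eq0.
have sX (p : {poly R}) : p != 0 -> size (2%:P * 'X * p) = (size p).+1.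
  by move=> p0; rewrite -mulrA mul_polyC size_scale// mulrC size_mulX.
elim: n => [|n [[s0 l0] [s1 l1]]].
  rewrite /= mul_polyC lead_coefZ lead_coefX size_scale// size_polyX.
  by rewrite size_poly1 lead_coef1 mulr1.
split=> //; rewrite chebyUSS.
have n10 : chebyU R n.+1 != 0 by rewrite -size_poly_gt0 s1.
have lt : (size (- chebyU R n)%R < size (2%:P * 'X * chebyU R n.+1)%R)%N.
  by rewrite size_polyN s0 sX// s1 ltnW.
rewrite size_polyDl// lead_coefDl// sX// s1; split=> //.
by rewrite -mulrA mul_polyC lead_coefZ lead_coefM lead_coefX l1 mul1r -exprS.
Qed.

Lemma size_lead_Qpoly lam n :
  size (Qpoly lam n) = n.+1 /\ lead_coef (Qpoly lam n) = 2 ^+ n.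
Proof.
have [s l] := size_lead_chebyU n; rewrite /Qpoly.
set t := - _; suff st : (size t < size (chebyU R n))%N.
  by rewrite size_polyDl// lead_coefDl.
rewrite /t size_polyN s ltnS (leq_trans (size_scale_leq _ _))//.
case: n {s l t} => [|[|n]]; rewrite ?size_poly0//.
by have [-> _] := size_lead_chebyU n.
Qed.


(** The recurrence starts at index 3 because Q_2 = 2 X Q_1 - (1 + r) Q_0 with r = lam / (2 - lam).
    This exception is the source of the special value of omega_1. *)
Lemma QpolySS lam n :
  Qpoly lam n.+3 = 2%:P * 'X * Qpoly lam n.+2 - Qpoly lam n.+1.
Proof.
rewrite /Qpoly chebyUSS; case: n => [|n] /=; rewrite -!mul_polyC; ring.
Qed.

(** By U_{k+2} + U_{k-2} = (4 X^2 - 2) U_k, the left side is ((1 + r)^2 - 4 r X^2) U_k for k = n +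
    1, and 1 + r = 2 / (2 - lam) gives the constants on the right. *)
Lemma Qpoly_chebyU lam n : lam < 2 ->
  Qpoly lam n.+1 - (lam / (2 - lam)) *: Qpoly lam n.+3 =
  (4 / (2 - lam) ^+ 2) *: ((1 - (lam * (2 - lam)) *: 'X^2) * chebyU R n.+1).
Proof.
move=> lam2; have d0 : 2 - lam != 0 by rewrite lt0r_neq0// subr_gt0.
set r := lam / _.
have -> : (4 / (2 - lam) ^+ 2) *: ((1 - (lam * (2 - lam)) *: 'X^2)
    * chebyU R n.+1) = ((1 + r) ^+ 2)%:P * chebyU R n.+1
    - (4 * r)%:P * 'X^2 * chebyU R n.+1.
  rewrite mulrBl mul1r scalerBr -scalerAl scalerA -!mul_polyC mulrA.
  by congr (_%:P * _ - _%:P * _ * _); rewrite /r; field.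
rewrite /Qpoly; case: n => [|n]; rewrite ?chebyUSS -?/r -!mul_polyC.
  by rewrite !rmorphM !rmorphD !rmorphM/=; ring.
by rewrite !rmorphM !rmorphD !rmorphM/=; ring.
Qed.

(* As if U_{-2} were -1, which is what the trigonometric formula gives. *)
Lemma Qpoly_chebyU0 lam : lam < 2 ->
  (1 + lam / (2 - lam))%:P - (lam / (2 - lam)) *: Qpoly lam 2 =
  (4 / (2 - lam) ^+ 2) *: ((1 - (lam * (2 - lam)) *: 'X^2) * chebyU R 0).
Proof.
move=> lam2; have d0 : 2 - lam != 0 by rewrite lt0r_neq0// subr_gt0.
set r := lam / _.
have -> : (4 / (2 - lam) ^+ 2) *: ((1 - (lam * (2 - lam)) *: 'X^2)
    * chebyU R 0) = ((1 + r) ^+ 2)%:P - (4 * r)%:P * 'X^2.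
  rewrite mulr1 scalerBr scalerA -!mul_polyC mulr1.
  by congr (_%:P - _%:P * _); rewrite /r; field.
by rewrite /Qpoly /= -/r -!mul_polyC !rmorphM !rmorphD !rmorphM/=; ring.
Qed.

(** For X = cos t this is the derivative of sin ((n+1) t) / sin t; the last bracket is the
    first-kind polynomial T_{n+1} = cos ((n+1) t). *)
Lemma deriv_chebyU n : (1 - 'X^2) * (chebyU R n)^`() =
  'X * chebyU R n - n.+1%:R * (chebyU R n.+1 - 'X * chebyU R n).
Proof.
suff [] : (1 - 'X^2) * (chebyU R n)^`() =
  'X * chebyU R n - n.+1%:R * (chebyU R n.+1 - 'X * chebyU R n) /\
  (1 - 'X^2) * (chebyU R n.+1)^`() =
  'X * chebyU R n.+1 - n.+2%:R * (chebyU R n.+2 - 'X * chebyU R n.+1) by [].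
elim: n => [|n [IH0 IH1]]; split => //.
- by rewrite /= derivC; ring.
- by rewrite /= derivM derivC derivX; ring.
rewrite [in LHS]chebyUSS derivB !derivM derivC derivX.
rewrite !mul0r !add0r mulr1 mulrBr mulrDr IH0 [_ * (_ * _^`())]mulrCA IH1.
have nS k : k.+1%:R = k%:R + 1 :> {poly R} by rewrite -natr1.
by rewrite !chebyUSS !nS; ring.
Qed.

(** The form a^2 - 2 x a b + b^2 is invariant under the recurrence step (a, b) -> (2 x a - b, a). *)
Lemma chebyU_pell n x :
  (chebyU R n.+1).[x] ^+ 2 - 2 * x * (chebyU R n.+1).[x] * (chebyU R n).[x]
  + (chebyU R n).[x] ^+ 2 = 1.
Proof.
elim: n => [|n IH]; first by rewrite /= hornerM hornerX !hornerC; ring.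
rewrite chebyUSS !hornerE; apply: etrans IH; ring.
Qed.

(** The first-kind value T = U_{n+1} - x U_n satisfies T^2 = 1 - (1 - x^2) U_n^2 <= 1 by
    [chebyU_pell], so each index adds at most 1 to the bound. *)
Lemma chebyU_le n x : `|x| <= 1 -> `|(chebyU R n).[x]| <= n.+1%:R.
Proof.
move=> x1; have x21 : x ^+ 2 <= 1 by rewrite -real_normK ?num_real// expr_le1.
elim: n => [|n IH]; first by rewrite /= hornerE normr1.
have T1 : `|(chebyU R n.+1).[x] - x * (chebyU R n).[x]| <= 1.
  rewrite -(@expr_le1 _ 2)// real_normK ?num_real// -[leRHS](chebyU_pell n x).
  rewrite -subr_ge0 [leRHS](_ : _ = (1 - x ^+ 2) * (chebyU R n).[x] ^+ 2).
    by rewrite mulr_ge0 ?sqr_ge0// subr_ge0.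
  by ring.
rewrite -[_.[x]](subrK (x * (chebyU R n).[x])) -natr1 addrC.
apply: (le_trans (ler_normD _ _)); apply: lerD => //.
by rewrite normrM (le_trans _ IH)// ler_piMl.
Qed.

Lemma Qpoly_le lam n x : 0 < lam <= 1 -> `|x| <= 1 ->
  `|(Qpoly lam n).[x]| <= 2 * n.+1%:R.
Proof.
move=> /andP[lam0 lam1] x1; rewrite /Qpoly hornerD hornerN hornerZ.
apply: (le_trans (ler_normB _ _)); rewrite mulr_natl mulr2n.
apply: lerD; first exact: chebyU_le.
have d0 : 0 < 2 - lam by lra.
rewrite normrM -[leRHS]mul1r ler_pM//.
  by rewrite ger0_norm ?(divr_ge0 (ltW lam0) (ltW d0))// ler_pdivrMr//; lra.
case: n => [|[|n]]; rewrite ?horner0 ?normr0//.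
by rewrite (le_trans (chebyU_le n x1))// ler_nat; lia.
Qed.

(* The sum runs over k <= n + 1. *)
Lemma psum_Qpoly lam u x n :
  (1 - 2 * u * x + u ^+ 2) *
    series (fun k => (Qpoly lam k).[x] * u ^+ k) n.+2 =
  1 - lam / (2 - lam) * u ^+ 2
  - (Qpoly lam n.+2).[x] * u ^+ n.+2 + (Qpoly lam n.+1).[x] * u ^+ n.+3.
Proof.
rewrite seriesEnat; elim: n => [|n IH].
  rewrite /= !big_nat_recr//= big_nil /Qpoly/=.
  rewrite !(hornerD, hornerN, hornerZ, hornerM, hornerX, horner0, hornerC).
  by move: (lam / _) => r; ring.
rewrite /= big_nat_recr//= mulrDr IH QpolySS.
move: (Qpoly lam n.+1) (Qpoly lam n.+2) => p q.
by rewrite !(hornerD, hornerN, hornerM, hornerX, hornerC) !exprS; ring.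
Qed.

Lemma cvg_geometric_natmul (z : R) : `|z| < 1 ->
  n.+1%:R * z ^+ n @[n --> \oo] --> 0.
Proof.
(* The square root splits |z|^n into w^n w^n: one factor absorbs n + 1, the other tends to 0. *)
move=> z1; apply/norm_cvg0P; pose w := Num.sqrt `|z|.
have w0 : 0 <= w by exact: sqrtr_ge0.
have zw : `|z| = w ^+ 2 by rewrite sqr_sqrtr.
have w1 : w < 1 by rewrite -[ltRHS]sqrtr1 ltr_sqrt.
(* (n + 1) w^n <= 1 + w + ... + w^n <= 1 / (1 - w) *)
have bnd n : n.+1%:R * w ^+ n * (1 - w) <= 1.
  elim: n => [|n IH]; first by rewrite expr0; lra.
  rewrite -natr1 exprS; have wn1 : w ^+ n <= 1 by rewrite exprn_ile1// ltW.
  have : w * (n.+1%:R * w ^+ n * (1 - w)) <= w * 1 by rewrite ler_wpM2l.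
  have : 0 <= w ^+ n by rewrite exprn_ge0.
  have : w * w ^+ n <= 1 by rewrite -exprS exprn_ile1// ltW.
  nra.
apply: (@squeeze_cvgr _ _ _ _ (cst 0) (fun n => (1 - w)^-1 * w ^+ n)).
- near=> n; rewrite normr_ge0/= normrM normrX zw ger0_norm// -exprM mul2n.
  rewrite -addnn exprD mulrA ler_wpM2r ?exprn_ge0//.
  by rewrite -[leRHS]mul1r ler_pdivlMr ?subr_gt0// bnd.
- exact: cvg_cst.
- rewrite -[X in _ --> X](mulr0 (1 - w)^-1); apply: cvgMr; apply: cvg_expr.
  by rewrite ger0_norm.
Unshelve. all: by end_near. Qed.

Lemma Qpoly_generating lam u x : 0 < lam <= 1 -> `|x| <= 1 -> `|u| < 1 ->
  series (fun n => (Qpoly lam n).[x] * u ^+ n) @ \oo --> psi lam u x.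
Proof.
move=> hlam x1 u1.
have Qu0 : (Qpoly lam n).[x] * u ^+ n @[n --> \oo] --> 0.
  apply/norm_cvg0P; apply: (@squeeze_cvgr _ _ _ _ (cst 0)
    (fun n => 2 * `|n.+1%:R * u ^+ n|)).
  - near=> n; rewrite normr_ge0/= !normrM mulrA ler_wpM2r//.
    by rewrite [X in 2 * X]ger0_norm// Qpoly_le.
  - exact: cvg_cst.
  - rewrite -[X in _ --> X](mulr0 2); apply: cvgMr.
    by apply/norm_cvg0P; exact: cvg_geometric_natmul.
(* The denominator is at least (1 - |u|)^2. *)
have D0 : 1 - 2 * u * x + u ^+ 2 != 0.
  have uu : `|u| ^+ 2 = u ^+ 2 by rewrite real_normK ?num_real.
  have : u * x <= `|u|.
    by rewrite (le_trans (ler_norm _))// normrM ler_piMr.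
  by move=> ux; rewrite lt0r_neq0//; nra.
pose a n := (Qpoly lam n).[x] * u ^+ n.
(* The shift by 2 matches the closed form of [psum_Qpoly], whose two boundary terms tend to 0 by
   [Qu0]. *)
rewrite -(cvg_shiftn 2) /= [X in X @ _](_ : _ = fun n =>
    (1 - lam / (2 - lam) * u ^+ 2 - a (n + 2)%N + u ^+ 2 * a (n + 1)%N)
    / (1 - 2 * u * x + u ^+ 2)); last first.
  apply/funext => n; rewrite addn2 addn1; apply/(canRL (mulfK D0)).
  by rewrite mulrC psum_Qpoly /a !exprS; ring.
rewrite /psi; apply: cvgMl.
rewrite -[X in _ --> X]addr0 -[X in _ --> X + _]subr0.
apply: cvgD; last first.
  rewrite -[X in _ --> X](mulr0 (u ^+ 2)); apply: cvgMr.
  by rewrite (cvg_shiftn 1 a).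
by apply: cvgB; [exact: cvg_cst | rewrite (cvg_shiftn 2 a)].
Unshelve. all: by end_near. Qed.

End chebyshev.

(** * An improper fundamental theorem of calculus, and arcsine up to the end points *)

Section calculus.
Variable R : realType.
Notation mu := (@lebesgue_measure R).
Implicit Types (a b x : R) (f F : R -> R).

(* The integrand may be unbounded near the end points. *)
Lemma ge0_FTC2_oo f F a b : a < b ->
  {in `]a, b[, forall x, 0 <= f x} -> {in `]a, b[, continuous f} ->
  derivable_oo_LRcontinuous F a b -> {in `]a, b[, derive1 F =1 f} ->
  (\int[mu]_(x in `]a, b[) (f x)%:E = (F b - F a)%:E)%E.
Proof.
move=> ab f0 cf [dF Fa Fb] F'.
(* The factor one third keeps [a + e n < b - e n] from n = 0 on. *)
pose e n := (b - a) / 3 * (n.+1%:R^-1).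
have d0 : 0 < (b - a) / 3 by rewrite divr_gt0// subr_gt0.
have e0 n : 0 < e n by rewrite mulr_gt0.
have e3 n : e n <= (b - a) / 3.
  by rewrite ler_piMr ?(ltW d0)// invf_le1// ler1n.
have ecvg : e n @[n --> \oo] --> 0.
  rewrite -[X in _ --> X](mulr0 ((b - a) / 3)); apply: cvgMr.
  exact: cvg_harmonic.
have acvg : a + e n @[n --> \oo] --> a.
  by rewrite -[X in _ --> X]addr0; apply: cvgD => //; exact: cvg_cst.
have bcvg : b - e n @[n --> \oo] --> b.
  by rewrite -[X in _ --> X]subr0; apply: cvgB => //; exact: cvg_cst.
pose I n := `[a + e n, b - e n]%classic.
have Iab n x : I n x -> x \in `]a, b[.
  rewrite /I/= !in_itv/= => /andP[ax xb]; have := e0 n.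
  by move=> e0n; apply/andP; split; lra.
have mf n : measurable_fun (I n) (EFin \o f).
  apply/measurable_EFinP; apply: subspace_continuous_measurable_fun.
    exact: measurable_itv.
  by apply: continuous_in_subspaceT => x /[!inE] /Iab; exact: cf.
(* Nonnegativity gives monotone convergence along the segments [I n], on each of which the usual
   theorem applies. *)
have cvgI : (\int[mu]_(x in I i) (f x)%:E)%E @[i --> \oo] -->
    (\int[mu]_(x in \bigcup_i I i) (f x)%:E)%E.
  apply: ge0_nondecreasing_set_cvg_integral => //.
  - apply/nondecreasing_seqP => n; apply/subsetPset => x.
    rewrite /I/= !in_itv/=.
    have : e n.+1 <= e n.
      rewrite ler_wpM2l ?(ltW d0)//.
      by rewrite lef_pV2 ?posrE// ler_nat.
    by move=> ee /andP[? ?]; apply/andP; split; lra.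
  - by move=> i; exact: measurable_itv.
  - by move=> n x /Iab /f0; rewrite lee_fin.
have UI : \bigcup_i I i = `]a, b[%classic.
  apply/seteqP; split => x; first by move=> [n _ /Iab].
  rewrite /= in_itv/= => /andP[ax xb].
  have [n _ nP] : \forall n \near \oo, a + e n < x /\ x < b - e n.
    near=> n; split; near: n; first exact: cvgr_lt acvg _ _.
    exact: cvgr_gt bcvg _ _.
  exists n => //; rewrite /I/= in_itv/=; have [] := nP n (leqnn n).
  by move=> /ltW -> /ltW ->.
have IE n : (\int[mu]_(x in I n) (f x)%:E = (F (b - e n) - F (a + e n))%:E)%E.
  have abn : a + e n < b - e n by have := e3 n; have := e0 n; lra.
  have Iin x : x \in `[a + e n, b - e n] -> x \in `]a, b[ by exact: Iab.
  rewrite (@continuous_FTC2 _ f F)//.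
  - by apply: continuous_in_subspaceT => x /[!inE] /Iab; exact: cf.
  - split.
    + by move=> x /subset_itv_oo_cc /Iin; exact: dF.
    + apply: cvg_at_right_filter; apply: differentiable_continuous.
      by apply/derivable1_diffP/dF/Iin; rewrite in_itv/= lexx ltW.
    + apply: cvg_at_left_filter; apply: differentiable_continuous.
      by apply/derivable1_diffP/dF/Iin; rewrite in_itv/= lexx ltW.
  - by move=> x /subset_itv_oo_cc /Iin; exact: F'.
have cvgF : (F (b - e i) - F (a + e i))%:E @[i --> \oo] --> (F b - F a)%:E.
  apply: cvg_EFin; first by near=> n.
  apply: cvgB.
    move/cvg_at_leftP : Fb; apply; split => // n.
    by rewrite ltrBlDr ltrDl.
  by move/cvg_at_rightP : Fa; apply; split => // n; rewrite ltrDl.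
move: cvgI; rewrite UI; under eq_cvg do rewrite IE.
by move=> cvgI; exact: (cvg_unique _ cvgI cvgF).
Unshelve. all: by end_near. Qed.

(** Inverse of the continuous [sin] on a segment; this reaches the end points, where [asin] has no
    finite derivative. *)
Lemma within_continuous_asin : {within `[-1, 1], continuous (@asin R)}.
Proof.
have p2 : - (pi / 2) <= pi / 2 :> R.
  by rewrite ge0_cp// divr_ge0// pi_ge0.
have := @segment_can_le_continuous R _ _ (@sin R) (@asin R) p2.
rewrite sinN sin_pihalf; apply; last exact: sinK.
by apply: continuous_subspaceT => x; exact: continuous_sin.
Qed.

Lemma cvg_asin_at_left1 : asin x @[x --> (1:R)^'-] --> asin (1 : R).
Proof. by have /continuous_within_itvP[] := within_continuous_asin. Qed.

Lemma cvg_asin_at_rightN1 : asin x @[x --> (-1:R)^'+] --> asin (-1 : R).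
Proof. by have /continuous_within_itvP[] := within_continuous_asin. Qed.

Lemma asin1 : asin 1 = pi / 2 :> R.
Proof.
have p2 : 0 <= pi / 2 :> R by rewrite divr_ge0// pi_ge0.
by have := @sinK R (pi / 2); rewrite sin_pihalf in_itv/= lexx ge0_cp// => ->.
Qed.

Lemma asinN1 : asin (-1) = - (pi / 2) :> R.
Proof.
have p2 : 0 <= pi / 2 :> R by rewrite divr_ge0// pi_ge0.
have := @sinK R (- (pi / 2)).
by rewrite sinN sin_pihalf in_itv/= lexx ge0_cp// => ->.
Qed.

End calculus.

(** * Integrals against the semicircle weight *)

Section chebyshev_integrals.
Variable R : realType.
Notation mu := (@lebesgue_measure R).
Implicit Types (x lam : R) (n : nat).

Let w x := Num.sqrt (1 - x ^+ 2).

Lemma subr_sqr_gt0 x : x \in `]-1, 1[ -> 0 < 1 - x ^+ 2.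
Proof. by rewrite in_itv/= => /andP[? ?]; nra. Qed.

Lemma is_derive_sqrt_circle x : x \in `]-1, 1[ ->
  is_derive x 1 (fun y : R => Num.sqrt (1 - y ^+ 2)) (- x / w x).
Proof.
move=> /subr_sqr_gt0 x1; have w0 : w x != 0 by rewrite sqrtr_eq0 -ltNge.
have d1 : is_derive x 1 (fun y : R => 1 - y ^+ 2) (- (2 * x)).
  apply: is_derive_eq; rewrite /GRing.scale/=; ring.
have := @is_derive1_comp R Num.sqrt (fun y => 1 - y ^+ 2) x _ _
  (is_derive1_sqrt x1) d1.
by move=> h; apply: (is_derive_eq h); rewrite -/(w x); field; exact: w0.
Qed.

Lemma continuous_sqrt_circle : continuous (fun x : R => Num.sqrt (1 - x ^+ 2)).
Proof.
move=> x; apply: (@continuous_comp _ _ _ (fun x : R => 1 - x ^+ 2) Num.sqrt).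
  by apply: cvgB; [exact: cvg_cst|exact: exprn_continuous].
exact: sqrt_continuous.
Qed.

Lemma continuous_poly_sqrt_circle (p : {poly R}) :
  continuous (fun x => p.[x] * Num.sqrt (1 - x ^+ 2)).
Proof.
move=> x; apply: cvgM; first exact: continuous_horner.
exact: continuous_sqrt_circle.
Qed.

(** Over the single denominator [w x] the numerator is polynomial, so checking an antiderivative
    becomes a polynomial identity. *)
Lemma is_derive_poly_sqrt_circle (p : {poly R}) x : x \in `]-1, 1[ ->
  is_derive x 1 (fun y => p.[y] * Num.sqrt (1 - y ^+ 2))
    (((1 - 'X^2) * p^`() - 'X * p).[x] / w x).
Proof.
move=> x1; have w0 : w x != 0 by rewrite sqrtr_eq0 -ltNge subr_sqr_gt0.
have ww : w x ^+ 2 = 1 - x ^+ 2 by rewrite sqr_sqrtr// ltW// subr_sqr_gt0.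
have d1 := is_derive_sqrt_circle x1.
apply: is_derive_eq; rewrite /GRing.scale/= -/(w x).
rewrite !(hornerD, hornerN, hornerM, hornerX, hornerXn, hornerC) -ww.
by field; exact: w0.
Qed.

Lemma integral_chebyU n :
  (\int[mu]_(x in `[(-1)%R, 1%R])
     ((chebyU R n.+1).[x] * Num.sqrt (1 - x ^+ 2))%:E = 0)%E.
Proof.
(* For x = cos t this comes from
   2 sin ((n+2) t) sin t = cos ((n+1) t) - cos ((n+3) t). *)
pose G : {poly R} := 2^-1 *: (n.+3%:R^-1 *: chebyU R n.+2
                              - n.+1%:R^-1 *: chebyU R n).
(* Since 1 - x^2 = w^2, this says that G w has derivative U_{n+1} w; and G w vanishes at both end
   points. *)
have GE : (1 - 'X^2) * G^`() - 'X * G = (1 - 'X^2) * chebyU R n.+1.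
  have dV k : k.+1%:R^-1 *: ((1 - 'X^2) * (chebyU R k)^`()) =
      k.+1%:R^-1 *: ('X * chebyU R k) - (chebyU R k.+1 - 'X * chebyU R k).
    rewrite deriv_chebyU scalerBr; congr (_ - _).
    by rewrite mulr_natl -[(_ - _) *+ _]scaler_nat scalerA mulVf ?scale1r//
      pnatr_eq0.
  rewrite /G derivZ derivB !derivZ -!scalerAr !mulrBr -!scalerAr !dV -scalerBr.
  apply: (@scalerI _ _ 2); first by rewrite pnatr_eq0.
  rewrite scalerA divff ?pnatr_eq0// scale1r !chebyUSS -!mul_polyC.
  by move: (chebyU R n) (chebyU R n.+1) => p q; ring.
have F0 x : x ^+ 2 = 1 -> G.[x] * Num.sqrt (1 - x ^+ 2) = 0.
  by move=> ->; rewrite subrr sqrtr0 mulr0.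
rewrite (@continuous_FTC2 _ _ (fun x => G.[x] * Num.sqrt (1 - x ^+ 2))).
- by rewrite !F0 ?sqrrN ?expr1n// -EFinB subrr.
- by rewrite -subr_gt0 opprK.
- by apply: continuous_subspaceT; exact: continuous_poly_sqrt_circle.
- split.
  + by move=> x /(is_derive_poly_sqrt_circle G) [].
  + by apply: cvg_at_right_filter; exact: continuous_poly_sqrt_circle.
  + by apply: cvg_at_left_filter; exact: continuous_poly_sqrt_circle.
- move=> x x1; have w0 : w x != 0 by rewrite sqrtr_eq0 -ltNge subr_sqr_gt0.
  have ww : w x ^+ 2 = 1 - x ^+ 2 by rewrite sqr_sqrtr// ltW// subr_sqr_gt0.
  have dG := is_derive_poly_sqrt_circle G x1.
  rewrite derive1E derive_val GE hornerM -/(w x).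
  rewrite hornerD hornerN hornerXn hornerC -ww.
  by field; exact: w0.
Qed.

Lemma integral_semicircle :
  (\int[mu]_(x in `[(-1)%R, 1%R]) (Num.sqrt (1 - x ^+ 2))%:E = (pi / 2)%:E)%E.
Proof.
(* The classical antiderivative of w; x is written as the value of ['X] so that
   [is_derive_poly_sqrt_circle] applies. *)
pose F x := 2^-1 * (asin x + ('X : {poly R}).[x] * Num.sqrt (1 - x ^+ 2)).
have F1 : F 1 = pi / 4.
  by rewrite /F asin1 expr1n subrr sqrtr0 mulr0 addr0; field.
have FN1 : F (-1) = - (pi / 4).
  by rewrite /F asinN1 sqrrN expr1n subrr sqrtr0 mulr0 addr0; field.
rewrite (@continuous_FTC2 _ _ F).
- by rewrite F1 FN1 -EFinB; congr EFin; field.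
- by rewrite -subr_gt0 opprK.
- by apply: continuous_subspaceT; exact: continuous_sqrt_circle.
- split.
  + move=> x x1; have d1 := is_derive_poly_sqrt_circle 'X x1.
    have d2 : is_derive x 1 (@asin R) (w x)^-1.
      by apply: is_derive1_asin; move: x1; rewrite in_itv.
    by apply: derivableM => //; apply: derivableD.
  + apply: cvgMr; apply: cvgD; first exact: cvg_asin_at_rightN1.
    by apply: cvg_at_right_filter; exact: continuous_poly_sqrt_circle.
  + apply: cvgMr; apply: cvgD; first exact: cvg_asin_at_left1.
    by apply: cvg_at_left_filter; exact: continuous_poly_sqrt_circle.
- move=> x x1; have w0 : w x != 0 by rewrite sqrtr_eq0 -ltNge subr_sqr_gt0.
  have ww : w x ^+ 2 = 1 - x ^+ 2 by rewrite sqr_sqrtr// ltW// subr_sqr_gt0.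
  have d1 := is_derive_poly_sqrt_circle 'X x1.
  have d2 : is_derive x 1 (@asin R) (w x)^-1.
    by apply: is_derive1_asin; move: x1; rewrite in_itv.
  rewrite derive1E derive_val /GRing.scale/= -/(w x).
  rewrite derivX !(hornerD, hornerN, hornerM, hornerX, hornerXn, hornerC).
  have -> : x * x = 1 - w x ^+ 2 by rewrite ww; ring.
  by field; exact: w0.
Qed.

End chebyshev_integrals.

(** * The unnormalized density and its integral *)

Section density_integral.
Variables (R : realType) (lam : R).
Hypothesis hlam : 0 < lam <= 1.
Notation mu := (@lebesgue_measure R).
Implicit Types (x : R).

Let w x := Num.sqrt (1 - x ^+ 2).
Let c := lam * (2 - lam).

(** As c = 1 - (1 - lam)^2, the denominator is (1 - x^2) + (1 - lam)^2 x^2. *)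
Lemma nu_denominator_gt0 x : x \in `]-1, 1[ -> 0 < 1 - c * x ^+ 2.
Proof.
move=> /subr_sqr_gt0 x1; have /andP[l0 l1] := hlam.
have : 0 <= (1 - lam) ^+ 2 * x ^+ 2 by rewrite mulr_ge0 ?sqr_ge0.
by rewrite /c; nra.
Qed.

(* With x = sin t, the antiderivative of the density is, up to a constant,
   t - s arctan (s tan t) for s = 1 - lam; writing arctan (s tan t) as
   t - arctan (h (sin t)) makes it continuous up to the end points for
   lam < 1, and at lam = 1 the term with h has coefficient 0. *)
Let h x := lam * ('X : {poly R}).[x] * w x / (1 - lam * x ^+ 2).

Let is_derive_h x : x \in `]-1, 1[ -> is_derive x 1 h
  (lam * (1 - (2 - lam) * x ^+ 2) / (w x * (1 - lam * x ^+ 2) ^+ 2)).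
Proof.
move=> x1; have /andP[l0 l1] := hlam.
have w0 : w x != 0 by rewrite sqrtr_eq0 -ltNge subr_sqr_gt0.
have ww : w x ^+ 2 = 1 - x ^+ 2 by rewrite sqr_sqrtr// ltW// subr_sqr_gt0.
have l2 : 1 - lam * x ^+ 2 != 0.
  by rewrite lt0r_neq0//; have := subr_sqr_gt0 x1; have := sqr_ge0 x; nra.
have d1 := is_derive_sqrt_circle x1.
have d2 : is_derive x 1 (fun y => (1 - lam * y ^+ 2)^-1)
    (2 * lam * x / (1 - lam * x ^+ 2) ^+ 2).
  have d : is_derive x 1 (fun y : R => 1 - lam * y ^+ 2) (- (2 * lam * x)).
    by apply: is_derive_eq; rewrite /GRing.scale/=; ring.
  have := @is_deriveV R (fun y : R => 1 - lam * y ^+ 2) x _ 1 l2 d.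
  move=> h'; apply: (is_derive_eq h'); rewrite /GRing.scale/=.
  by field; exact: l2.
apply: is_derive_eq; rewrite /GRing.scale/= -/(w x) hornerX derivX hornerC.
transitivity (lam * (2 * lam * x ^+ 2 * w x ^+ 2 + (1 - lam * x ^+ 2) *
    (w x ^+ 2 - x ^+ 2)) / (w x * (1 - lam * x ^+ 2) ^+ 2)).
  by field; apply/andP; split; [exact: l2|exact: w0].
by congr (_ / _); rewrite ww; ring.
Qed.

Lemma integral_nu_density :
  (\int[mu]_(x in `](-1)%R, 1%R[) (w x / (1 - c * x ^+ 2))%:E =
   (pi / (2 - lam))%:E)%E.
Proof.
have /andP[l0 l1] := hlam; have l2 : 2 - lam != 0 by rewrite lt0r_neq0//; lra.
pose F x := (2 - lam)^-1 * (asin x + (1 - lam) / lam * atan (h x)).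
have h1 x : x ^+ 2 = 1 -> h x = 0.
  by move=> x1; rewrite /h /w x1 subrr sqrtr0 mulr0 mul0r.
have F1 : F 1 = (pi / 2) / (2 - lam).
  by rewrite /F asin1 h1 ?expr1n// atan0 mulr0 addr0 mulrC.
have FN1 : F (-1) = - (pi / 2) / (2 - lam).
  by rewrite /F asinN1 h1 ?sqrrN ?expr1n// atan0 mulr0 addr0 mulrC.
have ch x : x ^+ 2 = 1 -> (1 - lam) / lam * atan (h y) @[y --> x] -->
    (1 - lam) / lam * atan (h x).
  move=> x1; have [->|ln1] := eqVneq lam 1.
    rewrite subrr !mul0r; under eq_cvg do rewrite mul0r; exact: cvg_cst.
  apply: cvgMr; apply: (@continuous_comp _ _ _ h atan); last first.
    exact: continuous_atan.
  apply: cvgM.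
    apply: cvgM; last exact: continuous_sqrt_circle.
    by apply: cvgMr; exact: continuous_horner.
  apply: cvgV; first by rewrite x1 mulr1 subr_eq0 eq_sym.
  apply: cvgB; first exact: cvg_cst.
  by apply: cvgMr; exact: exprn_continuous.
(* The open-interval version covers lam = 1, where the integrand is 1 / w and unbounded. *)
rewrite (@ge0_FTC2_oo _ _ F).
- by rewrite F1 FN1; congr EFin; field.
- by rewrite -subr_gt0 opprK.
- by move=> x /nu_denominator_gt0 x1; rewrite divr_ge0 ?sqrtr_ge0// ltW.
- move=> x /nu_denominator_gt0 x1; apply: cvgM.
    exact: continuous_sqrt_circle.
  apply: cvgV; first by rewrite lt0r_neq0.
  apply: cvgB; first exact: cvg_cst.
  by apply: cvgMr; exact: exprn_continuous.
- split.
  + move=> x x1; have d1 := is_derive_h x1.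
    have d2 : is_derive x 1 (@asin R) (w x)^-1.
      by apply: is_derive1_asin; move: x1; rewrite in_itv.
    have d3 := is_derive1_comp (is_derive1_atan (h x)) d1.
    by apply: derivableM => //; apply: derivableD => //; apply: derivableM.
  + apply: cvgMr; apply: cvgD; first exact: cvg_asin_at_rightN1.
    by apply: cvg_at_right_filter; apply: ch; rewrite sqrrN expr1n.
  + apply: cvgMr; apply: cvgD; first exact: cvg_asin_at_left1.
    by apply: cvg_at_left_filter; apply: ch; rewrite expr1n.
- move=> x x1; have w0 : w x != 0 by rewrite sqrtr_eq0 -ltNge subr_sqr_gt0.
  have ww : w x ^+ 2 = 1 - x ^+ 2 by rewrite sqr_sqrtr// ltW// subr_sqr_gt0.
  have d1 := is_derive_h x1.
  have d2 : is_derive x 1 (@asin R) (w x)^-1.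
    by apply: is_derive1_asin; move: x1; rewrite in_itv.
  have d3 := is_derive1_comp (is_derive1_atan (h x)) d1.
  rewrite derive1E derive_val.
  have D0 : 1 - lam * x ^+ 2 != 0.
    by rewrite lt0r_neq0//; have := subr_sqr_gt0 x1; have := sqr_ge0 x; nra.
  have C0 : 1 - c * x ^+ 2 != 0 by rewrite lt0r_neq0// nu_denominator_gt0.
  have lam0 : lam != 0 by rewrite lt0r_neq0.
  (* The derivative of the arctangent divides by 1 + h^2, and this brings in the denominator of the
     density. *)
  have -> : 1 + h x ^+ 2 = (1 - c * x ^+ 2) / (1 - lam * x ^+ 2) ^+ 2.
    transitivity (((1 - lam * x ^+ 2) ^+ 2 + lam ^+ 2 * x ^+ 2 * w x ^+ 2)
      / (1 - lam * x ^+ 2) ^+ 2).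
      by rewrite /h hornerX; field.
    by congr (_ / _); rewrite ww /c; ring.
  rewrite /GRing.scale/= -/(w x).
  transitivity (w x ^+ 2 / (w x * (1 - c * x ^+ 2))); last first.
    by field; rewrite w0 C0.
  rewrite ww; move: C0; rewrite /c => C0.
  by field; rewrite ?(C0, w0, D0, lam0, l2).
Qed.

End density_integral.

(** * Integration against a measure given by a density *)

Section density.
Context d (T : measurableType d) (R : realType).
Variables (mu nu : {measure set T -> \bar R}) (g : T -> R).
Hypotheses (g0 : forall x, 0 <= g x) (mg : measurable_fun setT g).
Hypothesis nuE :
  forall A, measurable A -> (nu A = \int[mu]_(x in A) (g x)%:E)%E.

Import HBNNSimple.
Local Open Scope ereal_scope.

Let mgE : measurable_fun setT (EFin \o g).
Proof. exact/measurable_EFinP. Qed.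

(** Linearity reduces the claim to the indicators of the fibres of [h], for which it is [nuE]. *)
Lemma integral_density_nnsfun (h : {nnsfun T >-> R}) :
  \int[nu]_x (h x)%:E = \int[mu]_x ((h x)%:E * (g x)%:E).
Proof.
rewrite integralT_nnsfun sintegralE.
transitivity (\int[mu]_x (\sum_(y \in range h)
    (y * \1_(h @^-1` [set y]) x)%:E * (g x)%:E)); last first.
  apply: eq_integral => x _.
  rewrite -ge0_mule_fsuml => [|y]; last exact: nnfun_muleindic_ge0.
  by rewrite fsumEFin// -(fimfunE _ x).
rewrite ge0_integral_fsum//; last 2 first.
  - move=> y; apply: emeasurable_funM => //; apply/measurable_EFinP.
    by apply: measurable_funM.
  - by move=> y x _; rewrite mule_ge0 ?lee_fin// -lee_fin nnfun_muleindic_ge0.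
apply: eq_fsbigr => r rh.
have r0 : (0 <= r)%R by move: rh; rewrite inE => -[x _ <-].
under [RHS]eq_integral do rewrite EFinM -muleA.
rewrite ge0_integralZl//; first last.
- by move=> x _; rewrite mule_ge0// lee_fin.
- by apply: emeasurable_funM => //; exact/measurable_EFinP.
rewrite nuE// [in LHS]integral_mkcond; congr (_ * _).
apply: eq_integral => x _; rewrite patchE indicE.
by case: ifPn; rewrite ?mul1e ?mul0e.
Qed.

(** Monotone convergence on both sides along simple approximations, which stay monotone after
    multiplication by [g >= 0]. *)
Lemma ge0_integral_density (f : T -> \bar R) : measurable_fun setT f ->
  (forall x, 0 <= f x) -> \int[nu]_x f x = \int[mu]_x (f x * (g x)%:E).
Proof.
move=> mf f0; pose h := nnsfun_approx measurableT mf.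
have hf x : (h n x)%:E @[n --> \oo] --> f x.
  by apply: (cvg_nnsfun_approx measurableT mf) => // ? _; exact: f0.
have ndh x : nondecreasing_seq (fun n => (h n x)%:E).
  by move=> a b ab; rewrite lee_fin; exact/lefP/nd_nnsfun_approx.
transitivity (lim ((\int[nu]_x (h n x)%:E) @[n --> \oo])).
  rewrite -monotone_convergence//.
  - by apply: eq_integral => x _; apply/esym/cvg_lim.
  - by move=> n; apply/measurable_EFinP.
  - by move=> n x _; rewrite lee_fin.
transitivity (lim ((\int[mu]_x ((h n x)%:E * (g x)%:E)) @[n --> \oo])).
  by under eq_fun do rewrite integral_density_nnsfun.
rewrite -monotone_convergence//.
- apply: eq_integral => x _; apply/cvg_lim => //.
  by apply: cvgeZr => //; exact: hf.
- by move=> n; apply: emeasurable_funM => //; exact/measurable_EFinP.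
- by move=> n x _; rewrite mule_ge0 ?lee_fin.
- by move=> x _ a b ab; rewrite lee_wpmul2r ?lee_fin//; exact: ndh.
Qed.

(* No integrability is required: the integral is the difference of the
   integrals of the positive and negative parts, whatever their values. *)
Lemma integral_density (f : T -> \bar R) : measurable_fun setT f ->
  \int[nu]_x f x = \int[mu]_x (f x * (g x)%:E).
Proof.
move=> mf; have posE (k : T -> \bar R) : (fun x => k x * (g x)%:E)^\+ =
    (fun x => k^\+ x * (g x)%:E).
  by apply/funext => x; rewrite !funeposE maxe_pMl ?lee_fin// mul0e.
have negE : (fun x => f x * (g x)%:E)^\- = (fun x => f^\- x * (g x)%:E).
  rewrite -funeposN -[f^\-]funeposN -posE; congr (_^\+).
  by apply/funext => x; rewrite mulNe.
rewrite integralE [RHS]integralE posE negE !ge0_integral_density//.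
- exact: measurable_funeneg.
- exact: measurable_funepos.
Qed.

End density.

(** * Invariance of the Lebesgue integral under reflection *)

Section lebesgue_reflection.
Variable R : realType.
Notation mu := (@lebesgue_measure R).
Local Open Scope ereal_scope.

(** The pushforward of Lebesgue measure by negation is Lebesgue measure. *)
Let ge0_integral_lebesgueN (f : R -> \bar R) : measurable_fun setT f ->
  (forall x, 0 <= f x) -> \int[mu]_x f (- x)%R = \int[mu]_x f x.
Proof.
move=> mf f0; pose N : measurableTypeR R -> measurableTypeR R := -%R.
have mN : measurable_fun setT N by exact: oppr_measurable.
have := @ge0_integral_pushforward _ _ _ _ R N mN mu setT f measurableT mf.
rewrite preimage_setT => <- //.
by apply: eq_measure_integral => A mA _; exact: lebesgue_measureN.
Qed.

Lemma integral_lebesgueN (f : R -> \bar R) : measurable_fun setT f ->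
  \int[mu]_x f (- x)%R = \int[mu]_x f x.
Proof.
move=> mf; rewrite -[LHS]/(\int[mu]_x (f \o -%R) x) integralE [RHS]integralE.
rewrite funepos_comp funeneg_comp !ge0_integral_lebesgueN//.
- exact: measurable_funeneg.
- exact: measurable_funepos.
Qed.

End lebesgue_reflection.

(** * Total mass and moments of [nu] *)

Section nu_moments.
Variables (R : realType) (lam : R).
Hypothesis hlam : 0 < lam <= 1.
Notation mu := (@lebesgue_measure R).
Implicit Types (p : {poly R}) (n : nat).

Let lam_gt0 : 0 < lam. Proof. by case/andP: hlam. Qed.
Let lam_le1 : lam <= 1. Proof. by case/andP: hlam. Qed.
Let lam2_gt0 : 0 < 2 - lam. Proof. by move: lam_le1; lra. Qed.
Let lam2_neq0 : 2 - lam != 0. Proof. by rewrite gt_eqF. Qed.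
Let pi_neq0 : pi != 0 :> R. Proof. by rewrite gt_eqF// pi_gt0. Qed.

Lemma integral_nu (f : R -> \bar R) : measurable_fun setT f ->
  (\int[nu hlam]_x f x = \int[mu]_x (f x * (nu_pdf lam x)%:E))%E.
Proof.
move=> mf; apply: integral_density => //.
- exact: nu_pdf_ge0.
- exact: measurable_nu_pdf.
Qed.

Lemma nu_setT : nu hlam setT = 1%E.
Proof.
pose f x := Num.sqrt (1 - x ^+ 2) / (1 - lam * (2 - lam) * x ^+ 2) : R.
have k0 : 0 < (2 - lam) / pi by rewrite divr_gt0// pi_gt0.
have pdfE x : x \in `](-1)%R, 1%R[ -> nu_pdf lam x = (2 - lam) / pi * f x.
  move=> x1; rewrite /nu_pdf indicE mem_set ?mulr1//.
  exact: subset_itv_oo_cc.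
rewrite /nu; transitivity (\int[mu]_(x in `[(-1)%R, 1%R]) (nu_pdf lam x)%:E)%E.
  rewrite [RHS]integral_mkcond; apply: eq_integral => x _.
  rewrite patchE; case: ifPn => // x1.
  by rewrite /nu_pdf indicE (negbTE x1) mulr0.
(* The end points form a null set; without them the denominator is positive even for lam = 1. *)
rewrite integral_itv_bndoo; last first.
  by apply/measurable_EFinP; apply: measurable_funTS; exact: measurable_nu_pdf.
transitivity (\int[mu]_(x in `](-1)%R, 1%R[)
    (((2 - lam) / pi)%:E * (f x)%:E))%E.
  by apply: eq_integral => x /[!inE] x1; rewrite pdfE// EFinM.
rewrite ge0_integralZl//; first last.
- by rewrite lee_fin ltW.
- move=> x x1; rewrite lee_fin divr_ge0 ?sqrtr_ge0// ltW//.
  exact: nu_denominator_gt0.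
- apply/measurable_EFinP.
  apply: (eq_measurable_fun (fun x => ((2 - lam) / pi)^-1 * nu_pdf lam x)).
    by move=> x /[!inE] x1; rewrite pdfE// mulKf// gt_eqF.
  apply: measurable_funM => //; apply: measurable_funTS.
  exact: measurable_nu_pdf.
rewrite integral_nu_density// -EFinM; congr EFin.
by move: pi pi_neq0 => q q0; field; rewrite lam2_neq0 q0.
Qed.

(** A finite set is Lebesgue-null, hence null for [nu]; with a null complement the total mass would
    be 0 instead of 1. *)
Lemma nu_not_finitely_supported : not_finitely_supported (nu hlam).
Proof.
move=> A finA nuA; have cA : countable A by exact: finite_set_countable.
have mA : measurable A by apply: countable_measurable.
have A0 : nu hlam A = 0%E.
  rewrite /nu null_set_integral//.
  - apply/measurable_EFinP; apply: measurable_funTS.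
    exact: measurable_nu_pdf.
  - exact: countable_lebesgue_measure0.
have := nu_setT; rewrite -(setUv A) measureU//; last 2 first.
- exact: measurableC.
- by rewrite setICr.
rewrite [X in (X + _)%E]A0 [X in (_ + X)%E]nuA adde0 => /eqP.
by rewrite eqe eq_sym oner_eq0.
Qed.

(** A polynomial is bounded on [-1, 1], the density vanishes elsewhere, and the total mass is
    finite. *)
Lemma integrable_poly_nu p : (nu hlam).-integrable setT (fun x => p.[x]%:E).
Proof.
have mp : measurable_fun setT (fun x : R => p.[x]%:E).
  by apply/measurable_EFinP; exact: measurable_poly.
apply/integrableP; split=> //; have [M pM] := poly_itv_bound p (-1) 1.
have M0 : 0 <= M by apply: (le_trans _ (pM 0 _)) => //; rewrite lerN10 ler01.
rewrite integral_nu; last exact: measurableT_comp.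
apply: (@le_lt_trans _ _ (\int[mu]_x (M%:E * (nu_pdf lam x)%:E))%E).
  have mpdf : measurable_fun setT (fun x => (nu_pdf lam x)%:E).
    by apply/measurable_EFinP; exact: measurable_nu_pdf.
  apply: ge0_le_integral => //.
  - by move=> x _; rewrite mule_ge0 ?lee_fin ?nu_pdf_ge0.
  - by apply: emeasurable_funM => //; exact: measurableT_comp.
  - by apply: emeasurable_funM.
  move=> x _; have [x1|x1] := boolP (x \in `[-1, 1]%classic).
    rewrite lee_wpmul2r ?lee_fin ?nu_pdf_ge0//; apply: pM.
    by move: x1; rewrite inE/= in_itv.
  by rewrite /nu_pdf indicE (negbTE x1) mulr0 !mule0.
rewrite -integral_nu; last exact: measurable_cst.
by rewrite integral_cst// [X in (_ * X)%E]nu_setT mule1 ltry.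
Qed.

(** Taken in [R], not in the extended reals, so that it can serve as the linear form [L] of the
    recurrence lemmas. *)
Definition nu_moment p : R := (\int[nu hlam]_x p.[x])%R.

Lemma nu_momentE p : (\int[nu hlam]_x p.[x]%:E = (nu_moment p)%:E)%E.
Proof.
rewrite /nu_moment /Rintegral fineK// integrable_fin_num//.
exact: integrable_poly_nu.
Qed.

Lemma nu_moment_is_linear : linear_for *%R nu_moment.
Proof.
move=> a p q; rewrite /nu_moment.
under eq_Rintegral do rewrite hornerD hornerZ.
rewrite RintegralD//.
- by rewrite RintegralZl//; exact: integrable_poly_nu.
- by have := integrable_poly_nu (a *: p); under eq_fun do rewrite hornerZ.
- exact: integrable_poly_nu.
Qed.

HB.instance Definition _ :=
  GRing.isLinear.Build R {poly R} R *%R nu_moment nu_moment_is_linear.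

Let nu_momentZ a p : nu_moment (a *: p) = a * nu_moment p.
Proof. exact: linearZ. Qed.

Lemma nu_moment1 : nu_moment 1 = 1.
Proof.
apply: EFin_inj; rewrite -nu_momentE.
under eq_integral do rewrite hornerC.
by rewrite integral_cst// [X in (_ * X)%E]nu_setT mule1.
Qed.

Lemma nu_pdfN x : nu_pdf lam (- x) = nu_pdf lam x.
Proof.
rewrite /nu_pdf sqrrN !indicE; congr (_ * (_ : bool)%:R).
by apply/idP/idP; rewrite !inE/= !in_itv/= => /andP[? ?];
  apply/andP; split; lra.
Qed.

(** The density is even and X is odd, so reflection changes the sign of the integral. *)
Lemma nu_momentX : nu_moment 'X = 0.
Proof.
suff : nu_moment 'X = - nu_moment 'X by lra.
rewrite -raddfN; apply: EFin_inj; rewrite -!nu_momentE.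
have mp p : measurable_fun setT (fun x : R => p.[x]%:E).
  by apply/measurable_EFinP; exact: measurable_poly.
rewrite !integral_nu// -integral_lebesgueN.
  by apply: eq_integral => x _; rewrite nu_pdfN hornerN !hornerX.
apply: emeasurable_funM => //; apply/measurable_EFinP; exact: measurable_nu_pdf.
Qed.

Lemma nu_moment_semicircle p :
  ((nu_moment ((1 - (lam * (2 - lam)) *: 'X^2) * p))%:E =
   ((2 - lam) / pi)%:E *
   \int[mu]_(x in `[(-1)%R, 1%R]) (p.[x] * Num.sqrt (1 - x ^+ 2))%:E)%E.
Proof.
rewrite -nu_momentE integral_nu; last first.
  by apply/measurable_EFinP; exact: measurable_poly.
rewrite -integralZl//; last first.
  apply: continuous_compact_integrable; first exact: segment_compact.
  by apply: continuous_subspaceT; exact: continuous_poly_sqrt_circle.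
rewrite [RHS]integral_mkcond; apply: eq_integral => x _; rewrite patchE.
rewrite /nu_pdf indicE; case: ifPn => x1; last by rewrite mulr0 mule0.
rewrite mulr1 -!EFinM; congr EFin.
rewrite hornerM hornerD hornerN hornerZ hornerXn hornerC.
(* The denominator vanishes only for lam = 1 at x = -1 and x = 1, where both
   sides are 0. *)
have [c0|c0] := eqVneq (1 - lam * (2 - lam) * x ^+ 2) 0; last first.
  by move: pi pi_neq0 => q q0; field; rewrite c0 q0.
rewrite (_ : Num.sqrt _ = 0) ?(mul0r, mulr0)//; apply: ler0_sqrtr.
have := sqr_ge0 (1 - lam); have := sqr_ge0 x; nra.
Qed.

Lemma nu_moment_Qpoly n : nu_moment (Qpoly lam n.+1) = 0.
Proof.
have l2 : lam < 2 by move: lam2_gt0; lra.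
have r0 : lam / (2 - lam) != 0 by rewrite mulf_neq0// ?invr_eq0 gt_eqF.
have step m : nu_moment (Qpoly lam m.+1) = 0 -> nu_moment (Qpoly lam m.+3) = 0.
  move=> m0; apply: (mulfI r0); rewrite mulr0; apply/eqP.
  have E0 : nu_moment ((1 - (lam * (2 - lam)) *: 'X^2) * chebyU R m.+1) = 0.
    by apply: EFin_inj; rewrite nu_moment_semicircle integral_chebyU mule0.
  have := congr1 nu_moment (Qpoly_chebyU m l2).
  move: E0; move: (_ * chebyU R m.+1) => s s0.
  rewrite raddfB/= !nu_momentZ m0 s0 sub0r mulr0 => /eqP.
  by rewrite oppr_eq0.
(* [step] advances the index by two, so the induction carries two consecutive indices. *)
suff [] : nu_moment (Qpoly lam n.+1) = 0 /\
  nu_moment (Qpoly lam n.+2) = 0 by [].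
elim: n => [|n [IH1 IH2]]; last by split=> //; exact: step.
split.
  rewrite /Qpoly/= scaler0 subr0 mul_polyC nu_momentZ nu_momentX; exact: mulr0.
apply: (mulfI r0); rewrite mulr0; apply/eqP.
have := congr1 nu_moment (Qpoly_chebyU0 l2); rewrite raddfB/= !nu_momentZ.
have -> : nu_moment (1 + lam / (2 - lam))%:P = 1 + lam / (2 - lam).
  by rewrite -[_%:P]mulr1 mul_polyC nu_momentZ nu_moment1 mulr1.
have -> : nu_moment ((1 - (lam * (2 - lam)) *: 'X^2) * 1) = (2 - lam) / 2.
  apply: EFin_inj; rewrite nu_moment_semicircle.
  under eq_integral do rewrite hornerC mul1r.
  rewrite integral_semicircle -EFinM; congr EFin.
  by move: pi pi_neq0 => q q0; field; exact: q0.
(* The right side is 0 because 1 + lam / (2 - lam) = 2 / (2 - lam). *)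
move=> E; suff -> : lam / (2 - lam) * nu_moment (Qpoly lam 2) =
    1 + lam / (2 - lam) - 4 / (2 - lam) ^+ 2 * ((2 - lam) / 2).
  by apply/eqP; field.
by rewrite -E; ring.
Qed.

End nu_moments.

(** * Orthogonality of [Qpoly] and the Jacobi-Szegö parameters of [nu] *)

Section Jacobi_Szego_nu.
Variables (R : realType) (lam : R).
Hypothesis hlam : 0 < lam <= 1.
Implicit Types (n : nat) (alpha omega : nat -> R).

Let lam2_neq0 : 2 - lam != 0.
Proof. by rewrite gt_eqF//; case/andP: hlam; lra. Qed.

Definition monic_Qpoly n : {poly R} := (2 ^+ n)^-1 *: Qpoly lam n.

Lemma size_monic_Qpoly n : size (monic_Qpoly n) = n.+1.
Proof.
rewrite size_scale ?invr_eq0 ?expf_neq0 ?pnatr_eq0//.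
by case: (size_lead_Qpoly lam n).
Qed.

Lemma monic_QpolyP n : monic_Qpoly n \is monic.
Proof.
rewrite monicE lead_coefZ; case: (size_lead_Qpoly lam n) => _ ->.
by rewrite mulVf// expf_neq0 ?pnatr_eq0.
Qed.

Lemma three_term_monic_Qpoly alpha omega : (forall n, alpha n = 0) ->
  omega 1%N = 1 / (2 * (2 - lam)) ->
  (forall n, (2 <= n)%N -> omega n = 1 / 4) ->
  three_term alpha omega monic_Qpoly.
Proof.
move=> a0 o1 o2 n; rewrite a0 subr0 /monic_Qpoly.
have s2 k : (2 ^+ k)^-1 = 2 * (2 ^+ k.+1)^-1 :> R.
  by rewrite exprS invfM mulrA divff ?pnatr_eq0// mul1r.
case: n => [|[|n]].
- rewrite scaler0 addr0 /Qpoly/= !scaler0 !subr0 expr0 expr1 invr1.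
  rewrite scale1r mulr1.
  by rewrite mul_polyC scalerA mulVf ?pnatr_eq0// scale1r.
- rewrite o1 /Qpoly/= !scaler0 !subr0 expr0 invr1 scale1r.
  rewrite [_ *: 1]alg_polyC -!mul_polyC.
  (* The factor 1 + r comes from Q_2 = 2 X Q_1 - (1 + r), and 1/4 from the monic normalization of
     Q_2. *)
  have -> : 1 / (2 * (2 - lam)) = (2 ^+ 2)^-1 * (1 + lam / (2 - lam)) by field.
  have -> : (2 ^+ 1)^-1 = 2 * (2 ^+ 2)^-1 :> R by field.
  by rewrite !rmorphM !rmorphD/= !rmorphM/=; ring.
- rewrite o2// QpolySS -!mul_polyC.
  have -> : (2 ^+ n.+2)^-1 = 2 * (2 ^+ n.+3)^-1 :> R by exact: s2.
  have -> : (2 ^+ n.+1)^-1 = 4 * (2 ^+ n.+3)^-1 :> R.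
    by rewrite s2 s2 mulrA; congr (_ * _); ring.
  have -> : (1 / 4)%:P = (4^-1)%:P :> {poly R} by rewrite div1r.
  have -> : (4^-1)%:P * ((4 * (2 ^+ n.+3)^-1)%:P * Qpoly lam n.+1) =
      ((2 ^+ n.+3)^-1)%:P * Qpoly lam n.+1.
    by rewrite mulrA -rmorphM/= mulrA mulVf ?mul1r// pnatr_eq0.
  by rewrite rmorphM/=; ring.
Qed.

(** The default 1/4 at index 0 makes [om] positive everywhere. *)
Let om n : R := if n == 1%N then 1 / (2 * (2 - lam)) else 1 / 4.

Let qE : three_term (cst 0) om monic_Qpoly.
Proof. by apply: three_term_monic_Qpoly => // -[|[]]. Qed.

Let L : {scalar {poly R}} := nu_moment hlam.

Let oq : orthogonal_for L monic_Qpoly.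
Proof.
apply: three_term_orthogonal qE size_monic_Qpoly _ => n.
by rewrite /monic_Qpoly linearZ/= nu_moment_Qpoly mulr0.
Qed.

(** Passage from the measure to the linear form: the integrability clause holds for every product of
    polynomials. *)
Lemma orthogonal_nu_moment (P : nat -> {poly R}) :
  (forall n, size (P n) = n.+1) ->
  orthogonal_polynomials (nu hlam) P <-> orthogonal_for L P.
Proof.
move=> sP; split=> [[_ oP] m n /oP[_]|oP].
  by under eq_integral do rewrite -hornerM; rewrite nu_momentE => -[].
split=> // m n mn; have PE x : (P m).[x] * (P n).[x] = (P m * P n).[x].
  by rewrite hornerM.
split; first by under eq_fun do rewrite PE; exact: integrable_poly_nu.
by under eq_integral do rewrite PE; rewrite nu_momentE; congr EFin; exact: oP.
Qed.

Lemma orthogonal_Qpoly : orthogonal_polynomials (nu hlam) (Qpoly lam).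
Proof.
apply/orthogonal_nu_moment => [n|m n /oq].
  by case: (size_lead_Qpoly lam n).
rewrite /monic_Qpoly -scalerAl -scalerAr !linearZ/= => /eqP.
by rewrite !mulf_eq0 !invr_eq0 !expf_eq0 pnatr_eq0 !andbF => /eqP.
Qed.

(** Left to right, [three_term_unique] compares the given family with [monic_Qpoly]; right to left,
    [monic_Qpoly] is the witness. *)
Lemma Jacobi_Szego_nuP alpha omega :
  Jacobi_Szego_parameters (nu hlam) alpha omega <->
  [/\ forall n, alpha n = 0, omega 1%N = 1 / (2 * (2 - lam)) &
      forall n, (2 <= n)%N -> omega n = 1 / 4].
Proof.
have l2 : 0 < 2 - lam by case/andP: hlam; lra.
have omgt0 n : 0 < om n.
  by rewrite /om; case: ifP => _; rewrite divr_gt0// mulr_gt0.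
(* By [three_term_norm] the squared norms start at L 1 = 1 and are multiplied by a positive [om] at
   each step. *)
have Lq n : L (monic_Qpoly n * monic_Qpoly n) != 0.
  rewrite gt_eqF//; elim: n => [|n IH].
    rewrite /monic_Qpoly expr0 invr1 scale1r /Qpoly scaler0 subr0 mulr1.
    by rewrite [L _](nu_moment1 hlam).
  by rewrite (three_term_norm _ qE oq) mulr_gt0.
split.
  move=> [_ _ _ [P [oP mP PE]]].
  (* A monic polynomial of size 1 is the constant 1. *)
  have P0 : monic_Qpoly 0 = P 0%N.
    rewrite /monic_Qpoly expr0 invr1 scale1r /Qpoly scaler0 subr0 /=.
    have [s _] := oP; have := size1_polyC (eq_leq (s 0%N)).
    have := mP 0%N; rewrite monicE lead_coefE s /= => /eqP -> ->.
    by rewrite polyC1.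
  have oP' : orthogonal_for L P.
    by apply/orthogonal_nu_moment => //; case: oP.
  have U := three_term_unique qE PE P0 oq oP' Lq.
  split.
  - by move=> n; have [] := U n.
  - by have [_ ->] := U 0%N.
  - by move=> [|[|n]]// _; have [_ ->] := U n.+1.
move=> [a0 o1 o2]; split.
- move=> n; have := integrable_poly_nu hlam 'X^n.
  by under eq_fun do rewrite hornerXn.
- exact: nu_not_finitely_supported.
- by move=> [|[|n]]// _; rewrite ?o1 ?o2// divr_gt0// mulr_gt0.
exists monic_Qpoly; split.
- by apply/orthogonal_nu_moment => //; exact: size_monic_Qpoly.
- exact: monic_QpolyP.
- exact: three_term_monic_Qpoly.
Qed.

End Jacobi_Szego_nu.

Unset Implicit Arguments.

Theorem mainTheorem4 (R : realType) (lam : R) (hlam : 0 < lam <= 1) :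
  [/\ nu hlam setT = 1%E,
      forall u x : R, `|x| <= 1 -> `|u| < 1 ->
        series (fun n : nat => (Qpoly lam n).[x] * u ^+ n) @ \oo
          --> psi lam u x,
      orthogonal_polynomials (nu hlam) (Qpoly lam) &
      forall alpha omega : nat -> R,
        Jacobi_Szego_parameters (nu hlam) alpha omega <->
        [/\ forall n : nat, alpha n = 0,
            omega 1%N = 1 / (2 * (2 - lam)) &
            forall n : nat, (2 <= n)%N -> omega n = 1 / 4]].
Proof.
split.
- exact: nu_setT.
- by move=> u x; exact: Qpoly_generating.
- exact: orthogonal_Qpoly.
- by move=> alpha omega; exact: Jacobi_Szego_nuP.
Qed.
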